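(* Let $V,Q$ be Hilbert spaces with duals $V',Q'$, and let $A:V\to V'$, $B:V\to Q'$, $C:Q\to Q'$ satisfy: (A1) $A$ is bounded, selfadjoint and positive definite, and $V$ is equipped with the inner product $(u,v)_A=\langle Au,v\rangle$ and norm $\|v\|_A^2=\langle Av,v\rangle$; (A2) $B$ is bounded; (A3) $C$ is bounded, selfadjoint and positive (semi)definite. Let $$\mathcal{A}_C=\begin{pmatrix} A & B' \\ B & -C \end{pmatrix}:V\times Q\to V'\times Q'.$$ Then $\mathcal{A}_C$ is an isomorphism if and only if $B$ satisfies the following inf-sup condition: there is a constant $\gamma_B>0$ such that for every $q\in Q$ $$\sup_{0\neq v\in V}\frac{\langle Bv,q\rangle}{\|v\|_A}\ \ge\ \gamma_B\|q\|-\|q\|_C .$$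
   Context: $\langle\cdot,\cdot\rangle$ denotes the duality pairing, $B':Q\to V'$ is the adjoint of $B$, i.e. $\langle B'q,v\rangle=\langle Bv,q\rangle$. $\|\cdot\|$ is the norm of $Q$, and $\|q\|_C=\langle Cq,q\rangle^{1/2}$ (a seminorm if $C$ is only semidefinite). $V$ is a Hilbert space for the norm $\|\cdot\|_A$. The product $V\times Q$ carries the norm $|\!|\!|(u,p)|\!|\!|^2=\|u\|_A^2+\|p\|_C^2+\|p\|^2$. ''Isomorphism'' means bounded linear bijection with bounded inverse. *)

(* Defs.v *)
(* MathComp-Analysis; all spaces are real, over an arbitrary realType. *)
From HB Require Import structures.
From mathcomp Require Export all_boot all_order all_algebra.
From mathcomp Require Export boolp classical_sets functions reals.
From mathcomp Require Export topology normedtype.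
Export Order.TTheory GRing.Theory Num.Theory.
Export numFieldNormedType.Exports.

Set Implicit Arguments.
Unset Strict Implicit.
Unset Printing Implicit Defensive.

Local Open Scope classical_set_scope.
Local Open Scope ring_scope.

(* Together with the completeness of [V : completeNormedModType R], this says
   that V is a real Hilbert space. *)
Definition hilbert_norm (R : realType) (V : normedModType R) : Prop :=
  exists ip : {dot V for (@idfun R)}, forall v : V, ip v v = `|v| ^+ 2.

(* The norms are explicit because V carries two of them (its own and the one
   defined by A) and V * Q does not carry the library's max norm. *)
Definition bounded_op (R : realType) (X Y : Type)
    (nX : X -> R) (nY : Y -> R) (f : X -> Y) : Prop :=
  exists c : R, forall x : X, nY (f x) <= c * nX x.

Definition complete_for (R : realType) (X : zmodType) (nX : X -> R) : Prop :=
  forall u : nat -> X,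
    (forall e : R, 0 < e -> exists N : nat, forall m n : nat,
      (N <= m)%N -> (N <= n)%N -> nX (u m - u n) < e) ->
    exists l : X, forall e : R, 0 < e -> exists N : nat, forall n : nat,
      (N <= n)%N -> nX (u n - l) < e.

Definition isomorphism (R : realType) (X Y : lmodType R)
    (nX : X -> R) (nY : Y -> R) (f : X -> Y) : Prop :=
  [/\ linear f, bounded_op nX nY f &
      exists g : Y -> X, [/\ cancel f g, cancel g f & bounded_op nY nX g]].

Section Dual.
Context {R : realType} (V : normedModType R).

Definition bounded_functional : {pred V -> R^o} :=
  fun f => `[< linear f /\ bounded_op Num.norm Num.norm f >].

Record dual : Type := Dual {
  dual_fun :> V -> R^o ;
  dual_mem : dual_fun \in bounded_functional }.

HB.instance Definition _ := [isSub for dual_fun].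
HB.instance Definition _ := [Choice of dual by <:].

Lemma bounded_functional_submod : submod_closed bounded_functional.
Proof.
split=> [|a f g /asboolP[lf [c cf]] /asboolP[lg [d dg]]].
  apply/asboolP; split; first by move=> k u v; rewrite scaler0 addr0.
  by exists 0 => v; rewrite mul0r normr0.
apply/asboolP; split=> [k u v|].
  rewrite !fctE lf lg !scalerDr !scalerA [a * k]mulrC.
  by rewrite addrACA.
exists (`|a| * c + d) => v; rewrite !fctE.
rewrite (le_trans (ler_normD _ _))// mulrDl lerD//.
by rewrite normrZ -mulrA ler_wpM2l.
Qed.

HB.instance Definition _ := GRing.isSubmodClosed.Build R (V -> R^o)
  bounded_functional bounded_functional_submod.
HB.instance Definition _ := [SubChoice_isSubLmodule of dual by <:].

Lemma dual_linear (f : dual) : linear f.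
Proof. by have /asboolP[] := dual_mem f. Qed.

Lemma dual0 (f : dual) : f 0 = 0.
Proof.
by have := dual_linear f (-1) 0 0; rewrite scaler0 addr0 scaleN1r addNr.
Qed.

Lemma dual_bounded (f : dual) : bounded_op Num.norm Num.norm f.
Proof. by have /asboolP[] := dual_mem f. Qed.

Definition dual_norm (f : dual) : R :=
  sup [set `|f v| | v in [set v : V | `|v| <= 1]].

Lemma dual_norm_has_sup (f : dual) :
  has_sup [set `|f v| | v in [set v : V | `|v| <= 1]].
Proof.
split; first by exists `|f 0|; exists 0 => //=; rewrite normr0.
have [c cf] := dual_bounded f; exists `|c| => _ [v /= v1 <-].
rewrite (le_trans (cf v))// (le_trans (ler_norm _))// normrM normr_id.
by rewrite ler_piMr.
Qed.

Lemma dual_norm_ub (f : dual) (v : V) : `|v| <= 1 -> `|f v| <= dual_norm f.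
Proof.
by move=> v1; apply: (sup_upper_bound (dual_norm_has_sup f)); exists v.
Qed.

Lemma dual_norm_le (f : dual) (c : R) :
  (forall v : V, `|v| <= 1 -> `|f v| <= c) -> dual_norm f <= c.
Proof.
move=> fc; apply: ge_sup; first by have [] := dual_norm_has_sup f.
by move=> _ [v v1 <-]; exact: fc.
Qed.

Lemma dual_norm_pairing (f : dual) (v : V) : `|f v| <= dual_norm f * `|v|.
Proof.
have [->|v0] := eqVneq v 0; first by rewrite dual0 !normr0 mulr0.
have nv : 0 < `|v| by rewrite normr_gt0.
have /(dual_norm_ub f) : `| `|v|^-1 *: v + 0| <= 1.
  by rewrite addr0 normrZ normfV normr_id mulVf ?gt_eqF.
by rewrite dual_linear dual0 addr0 normrZ normfV normr_id ler_pdivrMl// mulrC.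
Qed.

Lemma dual_norm_ge0 (f : dual) : 0 <= dual_norm f.
Proof.
by rewrite (le_trans (normr_ge0 (f 0)))// dual_norm_ub// normr0.
Qed.

Lemma dual_normD (f g : dual) : dual_norm (f + g) <= dual_norm f + dual_norm g.
Proof.
apply: dual_norm_le => v v1.
rewrite (le_trans (ler_normD _ _))// lerD//; exact: dual_norm_ub.
Qed.

Lemma dual_normZ (a : R) (f : dual) : dual_norm (a *: f) = `|a| * dual_norm f.
Proof.
have le (b : R) (g : dual) : dual_norm (b *: g) <= `|b| * dual_norm g.
  apply: dual_norm_le => v v1.
  by rewrite [leLHS]normrZ ler_wpM2l// dual_norm_ub.
apply/eqP; rewrite eq_le le /=; have [->|a0] := eqVneq a 0.
  by rewrite normr0 mul0r dual_norm_ge0.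
rewrite -ler_pdivlMl ?normr_gt0// -normfV.
by rewrite -[in leLHS](scalerK a0 f) le.
Qed.

Lemma dual_norm0_eq0 (f : dual) : dual_norm f = 0 -> f = 0.
Proof.
move=> f0; apply/val_inj/funext => v /=; apply/eqP.
by rewrite -normr_le0 (le_trans (dual_norm_pairing f v))// f0 mul0r.
Qed.

HB.instance Definition _ := Lmodule_isNormed.Build R dual
  dual_normD dual_normZ dual_norm0_eq0.

End Dual.

Section Operators.
Context {R : realType}.

Lemma adjoint_mem (V Q : normedModType R) (B : {linear V -> dual Q})
    (hB : bounded_op Num.norm Num.norm B) (q : Q) :
  (fun v : V => B v q) \in @bounded_functional R V.
Proof.
apply/asboolP; split=> [k u v|]; first by rewrite linearP.
have [c Bc] := hB; exists (c * `|q|) => v.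
rewrite (le_trans (dual_norm_pairing _ _))// mulrAC ler_wpM2r//; exact: Bc.
Qed.

Definition adjoint (V Q : normedModType R) (B : {linear V -> dual Q})
    (hB : bounded_op Num.norm Num.norm B) (q : Q) : dual V :=
  Dual (adjoint_mem hB q).

(* The (semi)norm v |-> <T v, v>^(1/2) of a positive (semi)definite T. *)
Definition form_norm (V : normedModType R) (T : V -> dual V) (v : V) : R :=
  Num.sqrt (T v v).

Definition triple_norm (V Q : normedModType R) (A : V -> dual V)
    (C : Q -> dual Q) (x : V * Q) : R :=
  Num.sqrt (form_norm A x.1 ^+ 2 + form_norm C x.2 ^+ 2 + `|x.2| ^+ 2).

Definition saddle_op (V Q : normedModType R) (A : {linear V -> dual V})
    (B : {linear V -> dual Q}) (hB : bounded_op Num.norm Num.norm B)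
    (C : {linear Q -> dual Q}) (x : V * Q) : dual V * dual Q :=
  (A x.1 + adjoint hB x.2, B x.1 - C x.2).

(* [sup set0 = 0] in R: for V = 0 the supremum over 0 <> v reads as 0. *)
Definition inf_sup (V Q : normedModType R) (A : V -> dual V)
    (B : V -> dual Q) (C : Q -> dual Q) : Prop :=
  exists2 gamma : R, 0 < gamma & forall q : Q,
    sup [set B v q / form_norm A v | v in [set v : V | v != 0]]
      >= gamma * `|q| - form_norm C q.

End Operators.

(* Main.v *)
Require Import Defs.
From mathcomp Require Import ring lra.

(** Since [A] is an isomorphism from [V] to its dual, the saddle point system
    [A u + B' p = f], [B u - C p = g] reduces to an equation for [p] alone.
    Write [w q] for the solution of [A (w q) = B' q]; eliminating
    [u = A^-1 f - w p] leaves [S p = B (A^-1 f) - g], where [S] is the Schur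
    complement [B A^-1 B' + C]. By the Riesz identity in the [A]-inner product,
    the supremum in the inf-sup condition is exactly the [A]-norm of [w q]
    ([sup_quotient_energy], [sup_lift]), while the quadratic form of [S] at [q]
    is [form_norm A (w q) ^+ 2 + form_norm C q ^+ 2] ([schur_formE]).
    The inf-sup condition is therefore the coercivity of [S] in disguise.

    If the inf-sup condition holds, [S] is symmetric, bounded and coercive, so
    Riesz representation in the inner product of [S] solves the reduced
    equation, and testing it with [p] itself bounds the solution by the data
    ([inf_sup_isomorphism]). Conversely, the system maps [(- w q, q)] to
    [(0, - (B (w q) + C q))], whose norm is at most a multiple of
    [form_norm A (w q) + form_norm C q]; a bounded inverse then bounds [`|q|] by
    the same quantity ([isomorphism_inf_sup]).

    The dual norms refer to the original norm of [V], whereas the solution is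
    measured by the [A]-norm. Both norms are complete and the second is bounded
    by the first, so they are equivalent by the open mapping theorem, which is
    proved for this situation by a nested ball argument followed by successive
    approximation ([complete_norm_dominates]). *)

Set Implicit Arguments.
Unset Strict Implicit.
Unset Printing Implicit Defensive.

Local Open Scope classical_set_scope.
Local Open Scope ring_scope.

(** * Norms given as functions, and their completeness *)

Section Norms.
Context {R : realType} {X : lmodType R}.

(** Norms are predicates on functions because one space carries several. *)
Definition is_norm (N : X -> R) : Prop :=
  [/\ forall x y, N (x + y) <= N x + N y,
      forall k x, N (k *: x) = `|k| * N x &
      forall x, N x = 0 -> x = 0].

Lemma is_norm0 N : is_norm N -> N 0 = 0.
Proof. by case=> _ NZ _; rewrite -(scale0r 0) NZ normr0 mul0r. Qed.

Lemma is_normN N x : is_norm N -> N (- x) = N x.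
Proof. by case=> _ NZ _; rewrite -scaleN1r NZ normrN1 mul1r. Qed.

Lemma is_norm_ge0 N x : is_norm N -> 0 <= N x.
Proof.
move=> hN; have [ND _ _] := hN.
by have := ND x (- x); rewrite subrr is_norm0// is_normN//; lra.
Qed.

Lemma is_norm_distC N x y : is_norm N -> N (x - y) = N (y - x).
Proof. by move=> hN; rewrite -opprB is_normN. Qed.

Lemma is_norm_dist_trans N y x z : is_norm N ->
  N (x - z) <= N (x - y) + N (y - z).
Proof. by case=> ND _ _; have := ND (x - y) (y - z); rewrite addrA subrK. Qed.

Lemma is_norm_le0 N x : is_norm N -> N x <= 0 -> x = 0.
Proof.
move=> hN Nx; have [_ _] := hN; apply; apply/eqP.
by rewrite eq_le Nx is_norm_ge0.
Qed.

End Norms.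

Lemma half_exp_small (R : realType) (c e : R) : 0 < e ->
  exists n : nat, c * 2^-1 ^+ n < e.
Proof.
move=> e0; have ce0 : 0 <= `|c| / e by rewrite divr_ge0// ltW.
exists (Num.bound (`|c| / e)).
set n := Num.bound _; have cn : `|c| / e < n%:R by exact: archi_boundP.
have n2 : n%:R < 2 ^+ n :> R by rewrite -natrX ltr_nat ltn_expl.
have h0 : 0 <= 2^-1 ^+ n :> R by rewrite exprn_ge0 ?invr_ge0.
apply: (le_lt_trans (ler_wpM2r h0 (ler_norm c))).
rewrite exprVn ltr_pdivrMr ?exprn_gt0// mulrC -ltr_pdivrMr//.
exact: lt_trans n2.
Qed.

Lemma le0_of_half_exp (R : realType) (c x : R) :
  (forall n : nat, x <= c * 2^-1 ^+ n) -> x <= 0.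
Proof.
move=> xc; rewrite leNgt; apply/negP => /(half_exp_small c)[n].
by rewrite ltNge xc.
Qed.

Lemma halving_bound (R : realType) (r : nat -> R) :
  (forall n, r n.+1 <= r n / 2) -> forall n, r n <= r 0%N * 2^-1 ^+ n.
Proof.
move=> rS; elim=> [|n IH]; first by rewrite expr0 mulr1.
by rewrite exprSr mulrA; have := rS n; lra.
Qed.

Section CompleteNorms.
Context {R : realType} {X : lmodType R}.

(** Steps bounded by a sequence that halves each time add up to at most twice
    the first bound, so the sequence is Cauchy and the same estimate passes to
    the limit. *)
Lemma complete_halving (N : X -> R) (u : nat -> X) (r : nat -> R) :
  is_norm N -> complete_for N ->
  (forall n, N (u n.+1 - u n) <= r n) -> (forall n, r n.+1 <= r n / 2) ->
  exists l, forall n, N (l - u n) <= 2 * r n.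
Proof.
move=> hN cN ur rS.
have r0 n : 0 <= r n by exact: le_trans (is_norm_ge0 _ hN) (ur n).
have tail n k : N (u (n + k)%N - u n) <= 2 * r n - 2 * r (n + k)%N.
  elim: k => [|k IH]; first by rewrite addn0 subrr is_norm0// subrr.
  have := is_norm_dist_trans (u (n + k)%N) (u (n + k.+1)%N) (u n) hN.
  by rewrite addnS; have := ur (n + k)%N; have := rS (n + k)%N; lra.
have tail2 n m : (n <= m)%N -> N (u m - u n) <= 2 * r n.
  move=> /subnKC <-; have := tail n (m - n)%N.
  by have := r0 (n + (m - n))%N; lra.
have [|l ul] := cN u.
  move=> e e0; have [n rn] := half_exp_small (4 * r 0%N) e0.
  exists n => i j ni nj.
  have := is_norm_dist_trans (u n) (u i) (u j) hN.
  rewrite (is_norm_distC (u n) _ hN).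
  have := tail2 _ _ ni; have := tail2 _ _ nj; have := halving_bound rS n.
  by rewrite -mulrA in rn; lra.
exists l => n; apply/ler_addgt0Pr => e /ul[k /(_ (maxn k n))].
rewrite leq_maxl => /(_ isT) lk.
have := is_norm_dist_trans (u (maxn k n)) l (u n) hN.
rewrite (is_norm_distC l (u (maxn k n)) hN).
by have := tail2 n _ (leq_maxr k n); lra.
Qed.

(** [v] lies in the [a]-closure of the set where [p] is at most [M]. *)
Definition approximable (p a : X -> R) (M : R) (v : X) : Prop :=
  forall e, 0 < e -> exists2 w, p w <= M & a (v - w) < e.

(** Baire's theorem for the [a]-closures of the sets where [p <= n], which cover
    the space: one of them contains a ball. Otherwise shrinking balls could be
    chosen, the [n]-th at positive distance from the points where [p <= n], and
    at the limit of their centers [p] would exceed every integer. *)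
Lemma approximable_ball (p a : X -> R) : is_norm a -> complete_for a ->
  exists (n : nat) (x : X) (r : R),
    0 < r /\ forall v, a (v - x) <= r -> approximable p a n%:R v.
Proof.
move=> ha ca; apply: contrapT => noball.
(* A pair is the center and radius of a ball. The factor [2] makes room for
   the distance from the center to the limit of the later centers. *)
pose avoids (ns : nat * (X * R)) (t : X * R) := 0 < ns.2.2 ->
  [/\ a (t.1 - ns.2.1) <= ns.2.2, 0 < t.2, t.2 <= ns.2.2 / 2 &
      forall w, p w <= ns.1%:R -> 2 * t.2 < a (t.1 - w)].
have /choice[F avoidF] : forall ns, exists t, avoids ns t.
  move=> [n [x r]]; have [r0|r0] := boolP (0 < r); last first.
    by exists (0, 0) => /=; rewrite /avoids /= (negbTE r0).
  have [v [vx [e [e0 ve]]]] : exists v, a (v - x) <= r /\ exists e, 0 < e /\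
      forall w, p w <= n%:R -> e <= a (v - w).
    apply: contrapT => nov; apply: noball; exists n, x, r; split=> // v vx e e0.
    apply: contrapT => now; apply: nov; exists v; split=> //; exists e.
    split=> // w pw; rewrite leNgt; apply/negP => vw; apply: now.
    by exists w.
  exists (v, Num.min (r / 2) (e / 4)) => _ /=; split=> //.
  - by rewrite lt_min !divr_gt0.
  - by rewrite ge_min lexx.
  - move=> w /ve ew; have : Num.min (r / 2) (e / 4) <= e / 4.
      by rewrite ge_min lexx orbT.
    by move: e0 ew; lra.
pose s := fix s n : X * R := if n is k.+1 then F (k, s k) else (0, 1).
have s0 n : 0 < (s n).2.
  by elim: n => [|n IH] //=; have [] := avoidF (n, s n) IH.
have sP n := avoidF (n, s n) (s0 n).
have [||l sl] := complete_halving (u := fun n => (s n).1)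
  (r := fun n => (s n).2) ha ca.
- by move=> n; case: (sP n).
- by move=> n; case: (sP n).
have pl : p l <= (Num.bound `|p l|)%:R.
  by rewrite (le_trans (ler_norm _))// ltW// archi_boundP.
have [_ _ _ /(_ _ pl)] := sP (Num.bound `|p l|).
by rewrite ltNge is_norm_distC// (sl (Num.bound `|p l|).+1).
Qed.

(** The open mapping theorem for the identity from [(X, p)] to [(X, a)]: some
    [p]-ball is [a]-dense in an [a]-ball around [0], so every [v] is
    within [a v / 2] of a point whose [p]-norm is at most [L * a v]. Repeating
    this on the error writes [v] as a series that converges for [p]. *)
Lemma complete_norm_dominates (p a : X -> R) (K : R) :
  is_norm p -> is_norm a -> complete_for p -> complete_for a ->
  (forall x, a x <= K * p x) ->
  exists2 c, 0 < c & forall x, p x <= c * a x.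
Proof.
move=> hp ha cp ca aKp.
have [pD pZ _] := hp; have [aD aZ _] := ha.
have [n [x [r [r0 ball]]]] := approximable_ball p ha ca.
(* Write [v] as a difference of two points of the ball. *)
have ball0 v : a v <= r -> approximable p a (2 * n%:R) v.
  move=> vr e e0; have e20 : 0 < e / 2 by lra.
  have [||w pw vw] := ball (v + x) _ (e / 2) => //; first by rewrite addrK.
  have [||w' pw' vw'] := ball x _ (e / 2) => //.
    by rewrite subrr is_norm0// ltW.
  exists (w - w'); first by have := pD w (- w'); rewrite is_normN//; lra.
  have -> : v - (w - w') = (v + x - w) - (x - w').
    by rewrite [v + x - w]addrAC addrKA opprK opprB addrA addrAC.
  by have := aD (v + x - w) (- (x - w')); rewrite is_normN//; lra.
(* The constant comes from rescaling [v] to length [r]. *)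
pose L := 2 * n%:R / r.
have L0 : 0 <= L by rewrite divr_ge0 ?mulr_ge0// ltW.
have /choice[f fP] : forall v, exists w, p w <= L * a v /\ a (v - w) <= a v / 2.
  move=> v; have [->|v0] := eqVneq v 0.
    by exists 0; rewrite subr0 (is_norm0 hp) (is_norm0 ha) mulr0 mul0r.
  have av0 : 0 < a v.
    by rewrite ltNge; apply: contra_neqN v0 => /(is_norm_le0 ha).
  pose k := r / a v; have k0 : 0 < k by rewrite divr_gt0.
  have [||w pw vw] := ball0 (k *: v) _ (r / 2).
  - by rewrite aZ gtr0_norm// divfK// gt_eqF.
  - by rewrite divr_gt0.
  exists (k^-1 *: w); split.
    have -> : L * a v = k^-1 * (2 * n%:R) by rewrite /k invf_div /L; ring.
    by rewrite pZ gtr0_norm ?invr_gt0// ler_wpM2l// invr_ge0 ltW.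
  have -> : v - k^-1 *: w = k^-1 *: (k *: v - w).
    by rewrite scalerBr scalerK// gt_eqF.
  rewrite aZ gtr0_norm ?invr_gt0// ler_pdivrMl// mulrA.
  by rewrite /k divfK ?gt_eqF// ltW.
clearbody L; exists (2 * L + 1); first by lra.
move=> v.
(* [z m] is the error left after [m] approximations. *)
pose z m := iter m (fun y => y - f y) v.
have zS m : a (z m.+1) <= a (z m) / 2 by case: (fP (z m)).
have [||l lP] := @complete_halving p (fun m => v - z m)
    (fun m => L * a (z m)) hp cp.
- move=> m /=; have -> : v - (z m - f (z m)) - (v - z m) = f (z m).
    by rewrite !opprB addrC subrKA addrC subrK.
  by case: (fP (z m)).
- by move=> m; have := ler_wpM2l L0 (zS m); rewrite mulrA.
have lv : l = v.
  apply/eqP; rewrite -subr_eq0; apply/eqP/(is_norm_le0 ha).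
  apply: (@le0_of_half_exp _ ((`|K| * (2 * L) + 1) * a v)) => m.
  have := is_norm_dist_trans (v - z m) l v ha.
  rewrite [v - z m - v]addrAC subrr add0r (is_normN (z m) ha).
  have := aKp (l - (v - z m)).
  have := ler_wpM2l (normr_ge0 K) (lP m).
  have : K * p (l - (v - z m)) <= `|K| * p (l - (v - z m)).
    by rewrite ler_wpM2r ?ler_norm// is_norm_ge0.
  have zm : a (z m) <= a v * 2^-1 ^+ m := halving_bound zS m.
  have c0 : 0 <= `|K| * (2 * L) + 1 by have := mulr_ge0 (normr_ge0 K) L0; lra.
  by have := ler_wpM2l c0 zm; move: (2^-1 ^+ m) => h; lra.
have := lP 0%N; rewrite /= subrr subr0 lv.
have := is_norm_ge0 v ha; lra.
Qed.

End CompleteNorms.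

(** * Symmetric positive forms and Riesz representation *)

Lemma discriminant_le0 (R : realType) (a b c : R) : 0 <= a ->
  (forall t, 0 <= a * t ^+ 2 + 2 * b * t + c) -> b ^+ 2 <= a * c.
Proof.
rewrite le_eqVlt => /predU1P[<-|a0] pos.
  have [->|b0] := eqVneq b 0; first by rewrite mul0r expr0n.
  (* A nonconstant affine function takes the value [-1]. *)
  have := pos (- (c + 1) / (2 * b)).
  have -> : 2 * b * (- (c + 1) / (2 * b)) = - (c + 1) by field; rewrite b0.
  by lra.
have := pos (- b / a).
have -> : a * (- b / a) ^+ 2 + 2 * b * (- b / a) + c = (a * c - b ^+ 2) / a.
  by field; rewrite gt_eqF.
by rewrite pmulr_lge0 ?invr_gt0// subr_ge0.
Qed.

Section Forms.
Context {R : realType} {X : lmodType R}.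

Record psd_form (b : X -> X -> R) : Prop := PsdForm {
  formDr : forall u v w, b u (v + w) = b u v + b u w ;
  formZr : forall u k v, b u (k *: v) = k * b u v ;
  formC : forall u v, b u v = b v u ;
  form_ge0 : forall v, 0 <= b v v }.

Definition energy (b : X -> X -> R) (v : X) : R := Num.sqrt (b v v).

Lemma energy_ge0 b v : 0 <= energy b v.
Proof. exact: sqrtr_ge0. Qed.

Variable b : X -> X -> R.
Hypothesis hb : psd_form b.

Lemma energy_sqr v : energy b v ^+ 2 = b v v.
Proof. by rewrite sqr_sqrtr// form_ge0. Qed.

Lemma formDl u v w : b (u + v) w = b u w + b v w.
Proof. by rewrite formC// formDr// ![b w _]formC. Qed.

Lemma formZl k u w : b (k *: u) w = k * b u w.
Proof. by rewrite formC// formZr// [b w _]formC. Qed.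

Lemma formBl u v w : b (u - v) w = b u w - b v w.
Proof. by rewrite -scaleN1r formDl formZl mulN1r. Qed.

Lemma form_sqr_line u v t :
  b (u + t *: v) (u + t *: v) = b v v * t ^+ 2 + 2 * b u v * t + b u u.
Proof.
by rewrite !(formDl, formDr hb, formZl, formZr hb) (formC hb v u); ring.
Qed.

Lemma form_le_energy u v : `|b u v| <= energy b u * energy b v.
Proof.
have uv : 0 <= energy b u * energy b v by rewrite mulr_ge0// energy_ge0.
rewrite -(ger0_norm uv) -ler_sqr ?nnegrE// !real_normK ?num_real//.
rewrite exprMn !energy_sqr mulrC discriminant_le0 ?form_ge0// => t.
by rewrite -form_sqr_line form_ge0.
Qed.

Lemma energy_is_norm : (forall v, v != 0 -> 0 < b v v) -> is_norm (energy b).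
Proof.
move=> bpos; split.
- move=> u v; rewrite -ler_sqr ?nnegrE ?addr_ge0 ?energy_ge0//.
  rewrite sqrrD !energy_sqr -[u + v]addr0 -(scale1r v) addr0.
  rewrite form_sqr_line !scale1r.
  by have := le_trans (ler_norm _) (form_le_energy u v); lra.
- move=> k v; rewrite /energy formZl formZr// mulrA -expr2 sqrtrM ?sqr_ge0//.
  by rewrite sqrtr_sqr.
- move=> v v0; apply/eqP/negPn/negP => /bpos.
  by rewrite -energy_sqr v0 expr0n ltxx.
Qed.

(** The representing vector minimizes [J v = b v v - 2 * f v]. A minimizing
    sequence is Cauchy by the parallelogram identity, and near-minimality of
    [u n] along every line forces [b (u n) v] to be close to [f v]. *)
Lemma riesz_representation (f : X -> R) (c : R) :
  (forall v, v != 0 -> 0 < b v v) -> complete_for (energy b) ->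
  (forall u v, f (u + v) = f u + f v) -> (forall k v, f (k *: v) = k * f v) ->
  (forall v, `|f v| <= c * energy b v) ->
  exists u, forall v, b u v = f v.
Proof.
move=> bpos bcomplete fD fZ fc.
pose J v := b v v - 2 * f v.
have J_line u v t :
    J (u + t *: v) = b v v * t ^+ 2 + 2 * (b u v - f v) * t + J u.
  by rewrite /J form_sqr_line fD fZ; ring.
have J_lb : has_inf (range J).
  split; first by exists (J 0); exists 0.
  exists (- c ^+ 2) => _ [v _ <-]; rewrite /J -energy_sqr.
  have := sqr_ge0 (energy b v - c); rewrite sqrrB.
  by have := le_trans (ler_norm _) (fc v); lra.
pose m := inf (range J).
have mJ v : m <= J v by apply: (ge_inf J_lb.2); exists v.
have /choice[u Ju] n : exists v, J v < m + (2^-1 ^+ n) ^+ 2.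
  have [|_ [v _ <-] Jv] := @inf_adherent _ (range J) ((2^-1 ^+ n) ^+ 2) _ J_lb.
    by rewrite !exprn_gt0// invr_gt0.
  by exists v.
have parallelogram v w : b (v - w) (v - w) <= 2 * (J v - m) + 2 * (J w - m).
  have := mJ (w + 2^-1 *: (v - w)).
  rewrite J_line (_ : J v = J (w + 1 *: (v - w))); last first.
    by rewrite scale1r addrC subrK.
  by rewrite J_line; lra.
have bN : is_norm (energy b) by exact: energy_is_norm.
have [||l lu] := complete_halving (N := energy b) (u := u)
  (r := fun n => 2 * 2^-1 ^+ n) bN bcomplete.
- move=> n; rewrite -ler_sqr ?nnegrE ?energy_ge0 ?mulr_ge0 ?exprn_ge0
    ?invr_ge0//.
  rewrite energy_sqr; have := parallelogram (u n.+1) (u n).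
  have := Ju n; have := Ju n.+1; rewrite [2^-1 ^+ n.+1]exprS.
  move: (2^-1 ^+ n) => h.
  rewrite !exprMn; have := sqr_ge0 h; set h2 := h ^+ 2; lra.
- by move=> n; rewrite exprS; lra.
have stationary n v : `|b (u n) v - f v| <= energy b v * 2^-1 ^+ n.
  have vn : 0 <= energy b v * 2^-1 ^+ n.
    by rewrite mulr_ge0 ?energy_ge0// exprn_ge0 ?invr_ge0.
  rewrite -(ger0_norm vn) -ler_sqr ?nnegrE// !real_normK ?num_real//.
  rewrite exprMn energy_sqr.
  apply: (@le_trans _ _ (b v v * (J (u n) - m))).
    apply: discriminant_le0; first exact: form_ge0.
    by move=> t; have := mJ (u n + t *: v); rewrite J_line; lra.
  by rewrite ler_wpM2l ?form_ge0//; have := Ju n; lra.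
exists l => v; apply/eqP; rewrite -subr_eq0 -normr_le0.
apply: (@le0_of_half_exp _ (5 * energy b v)) => n.
have -> : b l v - f v = (b l v - b (u n) v) + (b (u n) v - f v) by ring.
rewrite (le_trans (ler_normD _ _))//.
have := stationary n v; rewrite -formBl.
have := form_le_energy (l - u n) v.
have := ler_wpM2r (energy_ge0 b v) (lu n); lra.
Qed.

(** The supremum is attained at [w] unless [w = 0]; in that case the set of
    quotients is [[set 0]], or empty when the space is trivial, and its [sup] is
    [0] either way. *)
Lemma sup_quotient_energy w : (forall v, v != 0 -> 0 < b v v) ->
  sup [set b w v / energy b v | v in [set v | v != 0]] = energy b w.
Proof.
move=> bpos; set S := (X in sup X).
have epos v : v != 0 -> 0 < energy b v by move=> /bpos; rewrite sqrtr_gt0.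
have ubS x : S x -> x <= energy b w.
  move=> [v /= v0 <-]; rewrite ler_pdivrMr ?epos//.
  exact: le_trans (ler_norm _) (form_le_energy w v).
have [w0|w0] := eqVneq w 0; last first.
  apply/eqP; rewrite eq_le; apply/andP; split.
    by apply: ge_sup => //; exists (b w w / energy b w); exists w.
  apply: ub_le_sup; first by exists (energy b w).
  by exists w => //; rewrite -energy_sqr expr2 mulfK// gt_eqF// epos.
have ew : energy b w = 0.
  by rewrite /energy w0 -(scale0r 0) formZl mul0r sqrtr0.
rewrite ew; have S0 x : S x -> x = 0.
  move=> [v _ <-]; rewrite w0 -(scale0r 0) formZl !mul0r//.
have [/set0P[x Sx]|/negPn/eqP->] := boolP (S != set0); last exact: sup0.
rewrite (_ : S = [set 0]) ?sup1//; apply/seteqP.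
by split=> [y /S0->//|_ ->]; rewrite -(S0 x).
Qed.

End Forms.

(** * Normed spaces, their duals, and coercive forms *)

Lemma le_of_sqr_le_mul (R : realType) (s y : R) :
  0 <= y -> s ^+ 2 <= y * s -> s <= y.
Proof.
move=> y0; have [s0|s0 _] := ltP 0 s; last exact: le_trans y0.
by rewrite expr2 ler_pM2r.
Qed.

Section NormedSpaces.
Context {R : realType}.

Lemma normr_is_norm (V : normedModType R) : is_norm (Num.norm : V -> R).
Proof.
split; [exact: ler_normD | exact: normrZ | exact: normr0_eq0].
Qed.

Lemma normr_complete (V : completeNormedModType R) :
  complete_for (Num.norm : V -> R).
Proof.
move=> u cu; have /cauchy_cvgP : cauchy (u @ \oo).
  apply/cauchy_ballP => e e0; have [N uN] := cu e e0.
  exists ([set u n | n in [set n | (N <= n)%N]],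
          [set u n | n in [set n | (N <= n)%N]]) => /=.
    by split; exists N => // n /= Nn; exists n.
  by move=> [_ _] /= [[n Nn <-] [m Nm <-]]; rewrite -ball_normE /=; exact: uN.
move=> /cvg_ex[l ul]; exists l => e e0.
have /cvgr_dist_lt/(_ e e0)[N _ Nu] := ul.
by exists N => n Nn; rewrite distrC; exact: Nu.
Qed.

Lemma complete_for_equiv (X : zmodType) (p a : X -> R) (k K : R) :
  0 < k -> 0 < K ->
  (forall x, p x <= k * a x) -> (forall x, a x <= K * p x) ->
  complete_for p -> complete_for a.
Proof.
move=> k0 K0 pa ap cp u cu; have [|l ul] := cp u.
  move=> e e0; have [|N uN] := cu (e / k); first by rewrite divr_gt0.
  exists N => m n Nm Nn; rewrite (le_lt_trans (pa _))//.
  by rewrite mulrC -ltr_pdivlMr//; exact: uN.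
exists l => e e0; have [|N uN] := ul (e / K); first by rewrite divr_gt0.
exists N => n Nn; rewrite (le_lt_trans (ap _))//.
by rewrite mulrC -ltr_pdivlMr//; exact: uN.
Qed.

Lemma bounded_op_pos (X Y : Type) (nX : X -> R) (nY : Y -> R) (f : X -> Y) :
  (forall x, 0 <= nX x) -> bounded_op nX nY f ->
  exists2 c, 0 < c & forall x, nY (f x) <= c * nX x.
Proof.
move=> nX0 [c fc]; exists (`|c| + 1); first by rewrite ltr_wpDl.
move=> x; rewrite (le_trans (fc x))// ler_wpM2r//.
by rewrite (le_trans (ler_norm c))// lerDl.
Qed.

Lemma dual_addr (V : normedModType R) (f : dual V) u v : f (u + v) = f u + f v.
Proof. by rewrite -[u]scale1r dual_linear !scale1r. Qed.

Lemma dual_scaler (V : normedModType R) (f : dual V) k v :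
  f (k *: v) = k * f v.
Proof. by rewrite -[k *: v]addr0 dual_linear dual0 addr0. Qed.

Lemma dual_ext (V : normedModType R) (f g : dual V) : f =1 g -> f = g.
Proof. by move=> fg; apply/val_inj/funext. Qed.

(** A coercive bounded form has an energy norm equivalent to the given complete
    norm, so Riesz representation applies to it. *)
Lemma coercive_representation (H : completeNormedModType R) (b : H -> H -> R)
    (k K : R) : psd_form b -> (forall v, v != 0 -> 0 < b v v) ->
  0 < k -> (forall v, `|v| <= k * energy b v) ->
  0 < K -> (forall v, energy b v <= K * `|v|) ->
  forall f : dual H, exists u, forall v, b u v = f v.
Proof.
move=> hb bpos k0 vb K0 bv f.
have bc := complete_for_equiv k0 K0 vb bv (@normr_complete H).
apply: (riesz_representation hb (c := `|f| * k)) => //.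
- exact: dual_addr.
- exact: dual_scaler.
- move=> v; rewrite (le_trans (dual_norm_pairing f v))// -mulrA.
  by rewrite ler_wpM2l// dual_norm_ge0.
Qed.

End NormedSpaces.

Section Operators.
Context {R : realType}.

Lemma dual_addE (V : normedModType R) (f g : dual V) v : (f + g) v = f v + g v.
Proof. by []. Qed.

Lemma dual_subE (V : normedModType R) (f g : dual V) v : (f - g) v = f v - g v.
Proof. by []. Qed.

Lemma operator_form (V : normedModType R) (T : {linear V -> dual V}) :
  (forall u v, T u v = T v u) -> (forall v, 0 <= T v v) ->
  psd_form (fun u v => T u v).
Proof.
move=> TC T0; split=> //.
- by move=> u v w; exact: dual_addr.
- by move=> u k v; exact: dual_scaler.
Qed.

Lemma operator_pairing (V W : normedModType R) (T : V -> dual W) (c : R) :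
  (forall v, `|T v| <= c * `|v|) -> forall v w, `|T v w| <= c * `|v| * `|w|.
Proof.
move=> Tc v w; rewrite (le_trans (dual_norm_pairing _ _))//.
by rewrite ler_wpM2r//; exact: Tc.
Qed.

Lemma energy_bounded (V : normedModType R) (T : {linear V -> dual V}) :
  bounded_op Num.norm Num.norm T ->
  exists2 K, 0 < K & forall v, energy (fun u v => T u v) v <= K * `|v|.
Proof.
move=> /(bounded_op_pos (@normr_ge0 _ _))[c c0 Tc].
exists (c + 1); first by rewrite addr_gt0.
have cV (v : V) : 0 <= (c + 1) * `|v| by rewrite mulr_ge0// addr_ge0// ltW.
move=> v; rewrite -(ger0_norm (cV v)) -sqrtr_sqr ler_wsqrtr//.
rewrite (le_trans (ler_norm _))// (le_trans (operator_pairing Tc v v))//.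
rewrite -mulrA -expr2 exprMn ler_wpM2r ?sqr_ge0//.
by have := sqr_ge0 c; lra.
Qed.

End Operators.

(** * The saddle point operator *)

Section SaddlePoint.
Context {R : realType} {V Q : completeNormedModType R}.
Variables (A : {linear V -> dual V}) (B : {linear V -> dual Q}).
Variable C : {linear Q -> dual Q}.
Hypothesis A_bounded : bounded_op Num.norm Num.norm A.
Hypothesis A_selfadjoint : forall u v : V, A u v = A v u.
Hypothesis A_posdef : forall v : V, v != 0 -> 0 < A v v.
Hypothesis A_complete : complete_for (form_norm A).
Hypothesis B_bounded : bounded_op Num.norm Num.norm B.
Hypothesis C_bounded : bounded_op Num.norm Num.norm C.
Hypothesis C_selfadjoint : forall p q : Q, C p q = C q p.
Hypothesis C_possemidef : forall q : Q, 0 <= C q q.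

Local Notation data_norm :=
  (Num.norm : ((dual V * dual Q)%type : normedModType R) -> R).

Lemma data_normE (y : dual V * dual Q) :
  data_norm y = Num.max `|y.1| `|y.2|.
Proof. by []. Qed.

Lemma A_form : psd_form (fun u v => A u v).
Proof.
apply: operator_form => // v; have [->|/A_posdef/ltW//] := eqVneq v 0.
by rewrite dual0.
Qed.

Lemma C_form : psd_form (fun p q => C p q).
Proof. exact: operator_form. Qed.

(** Coercivity of [A] in the original norm of [V], a consequence of the
    completeness of both norms. *)
Lemma A_norm_dominates : exists2 k, 0 < k & forall v, `|v| <= k * form_norm A v.
Proof.
have [K K0 AK] := energy_bounded A_bounded.
apply: (complete_norm_dominates (K := K)) => //.
- exact: normr_is_norm.
- exact: energy_is_norm A_form A_posdef.
- exact: normr_complete.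
Qed.

Lemma A_surjective (f : dual V) : exists u, A u = f.
Proof.
have [K K0 AK] := energy_bounded A_bounded.
have [k k0 Ak] := A_norm_dominates.
have [u uf] := coercive_representation A_form A_posdef k0 Ak K0 AK f.
by exists u; exact: dual_ext.
Qed.

(** Test [A u] with [u] itself. *)
Lemma A_inverse_bounded k u : 0 < k -> (forall v, `|v| <= k * form_norm A v) ->
  form_norm A u <= k * `|A u|.
Proof.
move=> k0 Ak; apply: le_of_sqr_le_mul.
  by rewrite mulr_ge0// ltW.
rewrite (energy_sqr A_form) (le_trans (ler_norm _))//.
rewrite (le_trans (dual_norm_pairing _ _))//.
by rewrite -mulrA mulrCA ler_wpM2l// dual_norm_ge0.
Qed.

Lemma adjoint_norm c q : (forall v, `|B v| <= c * `|v|) -> 0 <= c ->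
  `|adjoint B_bounded q| <= c * `|q|.
Proof.
move=> Bc c0; apply: dual_norm_le => v v1.
rewrite (le_trans (operator_pairing Bc v q))// mulrAC ler_piMr//.
by rewrite mulr_ge0.
Qed.

Lemma adjoint_linear k p q : adjoint B_bounded (k *: p + q) =
  k *: adjoint B_bounded p + adjoint B_bounded q.
Proof. by apply: dual_ext => v; exact: (dual_linear (B v)). Qed.

(** [w q] is the [A]-Riesz representative of the functional [v |-> B v q], that
    is, [A^-1 (B' q)]. *)
Lemma lift_exists : exists w : Q -> V, forall q, A (w q) = adjoint B_bounded q.
Proof.
have /choice[w wB] : forall q, exists w, A w = adjoint B_bounded q.
  by move=> q; exact: A_surjective.
by exists w.
Qed.

(** The numerators are [A (w q) v], so the supremum is an [A]-dual norm. *)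
Lemma sup_lift (w : Q -> V) q : (forall q, A (w q) = adjoint B_bounded q) ->
  sup [set B v q / form_norm A v | v in [set v : V | v != 0]]
  = form_norm A (w q).
Proof.
move=> wB; rewrite -[RHS](sup_quotient_energy A_form)//.
by congr sup; apply: eq_imagel => v _; rewrite wB.
Qed.

Lemma component_le_triple (x : V * Q) :
  form_norm A x.1 <= triple_norm A C x /\ `|x.2| <= triple_norm A C x.
Proof.
have sq : 0 <= form_norm A x.1 ^+ 2 + form_norm C x.2 ^+ 2 + `|x.2| ^+ 2.
  by rewrite !addr_ge0 ?sqr_ge0.
have := sqr_ge0 (form_norm A x.1); have := sqr_ge0 (form_norm C x.2).
have := sqr_ge0 `|x.2|.
split; rewrite -ler_sqr ?nnegrE ?sqrtr_ge0// (sqr_sqrtr sq); lra.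
Qed.

Lemma triple_le_sum (x : V * Q) :
  triple_norm A C x <= form_norm A x.1 + form_norm C x.2 + `|x.2|.
Proof.
have a0 := energy_ge0 (fun u v => A u v) x.1.
have e0 := energy_ge0 (fun p q => C p q) x.2.
have s0 : 0 <= form_norm A x.1 + form_norm C x.2 + `|x.2|.
  by rewrite !addr_ge0.
rewrite -(ger0_norm s0) -sqrtr_sqr ler_wsqrtr//.
have := mulr_ge0 a0 e0; have := mulr_ge0 a0 (normr_ge0 x.2).
have := mulr_ge0 e0 (normr_ge0 x.2).
rewrite /energy -/(form_norm A x.1) -/(form_norm C x.2); nra.
Qed.

Lemma saddle_linear : linear (saddle_op A B_bounded C).
Proof.
move=> k [u p] [v q]; congr pair => /=.
  by rewrite linearP adjoint_linear scalerDr addrACA.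
by rewrite !linearP scalerDr addrACA.
Qed.

Lemma saddle_bounded :
  bounded_op (triple_norm A C) data_norm (saddle_op A B_bounded C).
Proof.
have [k k0 Ak] := A_norm_dominates.
have [cA cA0 Ac] := bounded_op_pos (@normr_ge0 _ _) A_bounded.
have [cB cB0 Bc] := bounded_op_pos (@normr_ge0 _ _) B_bounded.
have [cC cC0 Cc] := bounded_op_pos (@normr_ge0 _ _) C_bounded.
exists (cA * k + cB + cB * k + cC) => x; have [xA xQ] := component_le_triple x.
have tk := ler_wpM2l (ltW k0) xA.
have x1 := le_trans (Ak x.1) tk.
have t0 : 0 <= triple_norm A C x := sqrtr_ge0 _.
have := ler_wpM2l (ltW cA0) x1; have := ler_wpM2l (ltW cB0) x1.
have := ler_wpM2l (ltW cB0) xQ; have := ler_wpM2l (ltW cC0) xQ.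
have := mulr_ge0 (ltW cB0) t0; have := mulr_ge0 (ltW cC0) t0.
have := mulr_ge0 (mulr_ge0 (ltW cB0) (ltW k0)) t0.
have := mulr_ge0 (mulr_ge0 (ltW cA0) (ltW k0)) t0.
rewrite data_normE ge_max /=.
have := ler_normD (A x.1) (adjoint B_bounded x.2).
have := ler_normB (B x.1) (C x.2).
have := Ac x.1; have := Bc x.1; have := Cc x.2.
have := adjoint_norm x.2 Bc (ltW cB0).
by move=> *; apply/andP; split; lra.
Qed.

Lemma isomorphism_inf_sup :
  isomorphism (triple_norm A C) data_norm (saddle_op A B_bounded C) ->
  inf_sup A B C.
Proof.
move=> [_ _ [g [gK _ [c gc]]]].
have [k k0 Ak] := A_norm_dominates.
have [cB cB0 Bc] := bounded_op_pos (@normr_ge0 _ _) B_bounded.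
have [K K0 CK] := energy_bounded C_bounded.
have [w wB] := lift_exists.
pose D := `|c| * (cB * k + K) + 1.
have D0 : 0 < D by rewrite ltr_wpDl// mulr_ge0// addr_ge0 ?mulr_ge0// ltW.
exists D^-1; first by rewrite invr_gt0.
move=> q; rewrite (sup_lift _ wB) lerBlDr ler_pdivrMl//.
set a := form_norm A (w q); set e := form_norm C q.
have a0 : 0 <= a := sqrtr_ge0 _.
have e0 : 0 <= e := sqrtr_ge0 _.
have Ce : `|C q| <= K * e.
  apply: dual_norm_le => p p1; rewrite mulrC.
  rewrite (le_trans (form_le_energy C_form q p))// ler_wpM2l//.
  by rewrite (le_trans (CK p))// ler_piMr// ltW.
have image : saddle_op A B_bounded C (- w q, q) = (0, - (B (w q) + C q)).
  by rewrite /saddle_op /= !linearN wB addNr opprD.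
have := gc (saddle_op A B_bounded C (- w q, q)); rewrite gK image.
rewrite data_normE /= normr0 normrN max_r// => tc.
have [_ /= qt] := component_le_triple (- w q, q).
have Bw : `|B (w q)| <= cB * (k * a).
  by rewrite (le_trans (Bc _))// ler_wpM2l// ltW.
have BC := le_trans (ler_normD (B (w q)) (C q)) (lerD Bw Ce).
have cBC : c * `|B (w q) + C q| <= `|c| * (cB * (k * a) + K * e).
  by rewrite (le_trans (ler_wpM2r _ (ler_norm c)))// ler_wpM2l.
rewrite (le_trans qt)// (le_trans tc)// (le_trans cBC)//.
rewrite /D mulrDl mul1r -mulrA ler_wpDr ?addr_ge0// ler_wpM2l//.
have := mulr_ge0 (mulr_ge0 (ltW cB0) (ltW k0)) e0.
by have := mulr_ge0 (ltW K0) a0; lra.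
Qed.

(** The form of the Schur complement [B A^-1 B' + C]. *)
Definition schur_form (w : Q -> V) (p q : Q) : R := B (w p) q + C p q.

Lemma schur_formE w p q : (forall q, A (w q) = adjoint B_bounded q) ->
  schur_form w p q = A (w p) (w q) + C p q.
Proof. by move=> wB; rewrite /schur_form A_selfadjoint wB. Qed.

Lemma schur_psd w : (forall q, A (w q) = adjoint B_bounded q) ->
  psd_form (schur_form w).
Proof.
move=> wB; split.
- by move=> u p q; rewrite /schur_form !dual_addr addrACA.
- by move=> u t q; rewrite /schur_form !dual_scaler mulrDr.
- by move=> p q; rewrite !schur_formE// A_selfadjoint C_selfadjoint.
- by move=> q; rewrite schur_formE// addr_ge0// (form_ge0 A_form).
Qed.

(** By [schur_formE] the form of [S] is the sum of the squares of both left-hand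
    sides; with the inf-sup condition this makes it coercive. *)
Lemma components_le_schur w q : (forall q, A (w q) = adjoint B_bounded q) ->
  form_norm A (w q) <= energy (schur_form w) q /\
  form_norm C q <= energy (schur_form w) q.
Proof.
move=> wB; split; rewrite ler_wsqrtr// schur_formE//.
  by rewrite lerDl.
by rewrite lerDr (form_ge0 A_form).
Qed.

Lemma inf_sup_isomorphism : inf_sup A B C ->
  isomorphism (triple_norm A C) data_norm (saddle_op A B_bounded C).
Proof.
move=> [gamma gamma0 infsup].
have [k k0 Ak] := A_norm_dominates.
have [cB cB0 Bc] := bounded_op_pos (@normr_ge0 _ _) B_bounded.
have [K K0 CK] := energy_bounded C_bounded.
have [w wB] := lift_exists.
have hS := schur_psd wB.
set S := schur_form w in hS.
have adjc q := adjoint_norm q Bc (ltW cB0).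
pose m := 2 / gamma; have m0 : 0 < m by rewrite divr_gt0.
have coercive q : `|q| <= m * energy S q.
  have := infsup q; rewrite (sup_lift _ wB).
  have [] := components_le_schur q wB; rewrite -/S => aS eS gq.
  by rewrite /m mulrAC ler_pdivlMr// mulrC; lra.
have lift_le q : form_norm A (w q) <= k * (cB * `|q|).
  by rewrite (le_trans (A_inverse_bounded _ k0 Ak))// wB ler_wpM2l// ltW.
pose M := k * cB + K; have M0 : 0 < M by rewrite addr_gt0// mulr_gt0.
have S_le q : energy S q <= M * `|q|.
  have sM : 0 <= M * `|q| by rewrite mulr_ge0// ltW.
  rewrite -ler_sqr ?nnegrE ?energy_ge0// energy_sqr// /S schur_formE//.
  rewrite -(energy_sqr A_form) -(energy_sqr C_form).
  have := lift_le q; have := CK q; rewrite /form_norm /M.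
  have := energy_ge0 (fun u v => A u v) (w q).
  have := energy_ge0 (fun p q => C p q) q.
  set e := energy _ q; set a := energy _ (w q) => e0 a0 eq aq.
  have := ler_pM a0 a0 aq aq; have := ler_pM e0 e0 eq eq.
  have := mulr_ge0 (le_trans a0 aq) (le_trans e0 eq).
  by rewrite -!expr2; lra.
have S_pos q : q != 0 -> 0 < S q q.
  move=> q0; rewrite -energy_sqr// exprn_gt0//.
  by rewrite -(pmulr_rgt0 _ m0) (lt_le_trans _ (coercive q))// normr_gt0.
have estimate x : triple_norm A C x <=
    (k * (1 + cB * (m * (k + m))) + (k + m) + m * (k + m))
      * data_norm (saddle_op A B_bounded C x).
  case: x => u p; rewrite data_normE /=.
  set f := A u + _; set h := B u - _; set y := Num.max _ _.
  have fy : `|f| <= y by rewrite le_max lexx.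
  have hy : `|h| <= y by rewrite le_max lexx orbT.
  have y0 : 0 <= y := le_trans (normr_ge0 f) fy.
  have [] := components_le_schur p wB; rewrite -/S.
  set s := energy S p => ws es.
  have s0 : 0 <= s by exact: energy_ge0.
  have pm : `|p| <= m * s by exact: coercive.
  have wk : `|w p| <= k * s by rewrite (le_trans (Ak _))// ler_wpM2l// ltW.
  (* Testing the first equation with [w p] and the second with [p] makes the
     terms [A u (w p)] and [B u p] cancel. *)
  have Spp : S p p = f (w p) - h p.
    rewrite dual_addE dual_subE A_selfadjoint wB /S /schur_form /=.
    by rewrite addrAC opprB addrCA subrr; lra.
  have sy : s <= (k + m) * y.
    apply: le_of_sqr_le_mul; first by rewrite mulr_ge0// addr_ge0// ltW.
    have := ler_pM (normr_ge0 f) (normr_ge0 (w p)) fy wk.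
    have := ler_pM (normr_ge0 h) (normr_ge0 p) hy pm.
    have : f (w p) <= `|f| * `|w p|.
      exact: le_trans (ler_norm _) (dual_norm_pairing f (w p)).
    have : - h p <= `|h| * `|p|.
      by rewrite (le_trans _ (dual_norm_pairing h p))// -normrN ler_norm.
    by rewrite energy_sqr// Spp; lra.
  have pY : `|p| <= m * ((k + m) * y).
    by rewrite (le_trans pm)// ler_wpM2l// ltW.
  have uY : form_norm A u <= k * (y + cB * (m * ((k + m) * y))).
    rewrite (le_trans (A_inverse_bounded _ k0 Ak))// ler_wpM2l ?(ltW k0)//.
    have -> : A u = f - adjoint B_bounded p by rewrite addrK.
    rewrite (le_trans (ler_normB _ _))// lerD// (le_trans (adjc p))//.
    by rewrite ler_wpM2l// ltW.
  rewrite (le_trans (triple_le_sum _))//=.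
  by have := le_trans es sy; lra.
have /choice[g gK] : forall y, exists x, saddle_op A B_bounded C x = y.
  move=> [f h]; have [u0 Au0] := A_surjective f.
  have [p Sp] :=
    coercive_representation hS S_pos m0 coercive M0 S_le (B u0 - h).
  exists (u0 - w p, p); congr pair => /=.
    by rewrite linearB /= Au0 wB subrK.
  apply: dual_ext => q; rewrite linearB !dual_subE.
  by have := Sp q; rewrite dual_subE /S /schur_form; lra.
split; [exact: saddle_linear | exact: saddle_bounded |].
exists g; split=> //; last first.
  by eexists => y; rewrite -{2}(gK y); exact: estimate.
move=> x; pose z := -1 *: x + g (saddle_op A B_bounded C x).
have z0 : triple_norm A C z <= 0.
  rewrite (le_trans (estimate z))// /z saddle_linear gK scaleN1r addNr.
  by rewrite data_normE !normr0 maxxx mulr0.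
have [/le_trans/(_ z0) z1 /le_trans/(_ z0)] := component_le_triple z.
rewrite normr_le0 => /eqP z2.
have {}z1 := is_norm_le0 (energy_is_norm A_form A_posdef) z1.
apply/eqP; rewrite -subr_eq0 addrC -scaleN1r -/z.
by rewrite [z]surjective_pairing z1 z2.
Qed.

End SaddlePoint.

Theorem theorem1 (R : realType) (V Q : completeNormedModType R)
    (hV : hilbert_norm V) (hQ : hilbert_norm Q)
    (A : {linear V -> dual V}) (B : {linear V -> dual Q})
    (C : {linear Q -> dual Q})
    (A_bounded : bounded_op Num.norm Num.norm A)
    (A_selfadjoint : forall u v : V, A u v = A v u)
    (A_posdef : forall v : V, v != 0 -> 0 < A v v)
    (A_complete : complete_for (form_norm A))
    (B_bounded : bounded_op Num.norm Num.norm B)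
    (C_bounded : bounded_op Num.norm Num.norm C)
    (C_selfadjoint : forall p q : Q, C p q = C q p)
    (C_possemidef : forall q : Q, 0 <= C q q) :
  isomorphism (triple_norm A C) Num.norm
    (saddle_op A B_bounded C)
  <-> inf_sup A B C.
Proof.
split; first exact: isomorphism_inf_sup.
exact: inf_sup_isomorphism.
Qed.
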